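(* Let $\Omega$ be a Hausdorff space, $X$ be a complex Banach space, and $A$ be the base algebra of $A(\Omega,X)$. Suppose that the set $\rho A$ of strong peak points for $A$ is a norming subset of $\Omega$. If $X$ has the Daugavet property, then $A(\Omega,X)$ also has the Daugavet property.
   Context: All Banach spaces are complex. $C_b(\Omega,X)$ is the Banach space of bounded continuous functions $\Omega\to X$ with the supremum norm, and $C_b(\Omega)=C_b(\Omega,\mathbb{C})$. A function algebra on $\Omega$ is a closed subspace (subalgebra) of $C_b(\Omega)$ that separates the points of $\Omega$ and contains the constants. $A(\Omega,X)$ denotes a closed subspace of $C_b(\Omega,X)$ such that: (i) the base algebra $A=\{x^*\circ f: f\in A(\Omega,X),\ x^*\in X^*\}$ is a function algebra; (ii) $A\otimes X\subset A(\Omega,X)$ (i.e. $t\mapsto\varphi(t)x$ is in $A(\Omega,X)$ for $\varphi\in A$, $x\in X$); (iii) $fg\in A(\Omega,X)$ for every $f\in A$, $g\in A(\Omega,X)$. A point $t_0\in\Omega$ is a strong peak point for $A$ if there is $f\in A$ with $|f(t_0)|=\|f\|_\infty$ and $\sup_{t\in\Omega\setminus U}|f(t)|<\|f\|_\infty$ for every open neighborhood $U$ of $t_0$; $\rho A$ is the set of strong peak points. $\rho A$ is norming if $\|f\|=\sup_{t\in\rho A}|f(t)|$ for all $f\in A$ (equivalently $\|f\|=\sup_{t\in\rho A}\|f(t)\|$ for all $f\in A(\Omega,X)$). A Banach space $Z$ has the Daugavet property if $\|\mathrm{Id}_Z+T\|=1+\|T\|$ for every rank-one bounded linear operator $T:Z\to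 Z$. *)

(* Defs.v *)
From HB Require Import structures.
From mathcomp Require Import all_boot all_order all_algebra.
From mathcomp Require Import all_classical all_reals all_analysis.
From mathcomp Require Export complex.

Set Implicit Arguments.
Unset Strict Implicit.
Unset Printing Implicit Defensive.

Import Order.TTheory GRing.Theory Num.Theory.
Import numFieldNormedType.Exports.

Local Open Scope classical_set_scope.
Local Open Scope ring_scope.
Local Open Scope complex_scope.

Section RealNorm.
Context {R : realType} {V : normedModType R[i]}.

(* The norm of a normed module over R[i] takes its values in R[i]; they are
   nonnegative, hence real, and rnorm reads them in R, where sup lives. *)
Definition rnorm (x : V) : R := complex.Re `|x|.

Lemma rnormE (x : V) : `|x| = (rnorm x)%:C.
Proof. by rewrite /rnorm RRe_real// ger0_real. Qed.

Lemma rnorm_ge0 (x : V) : 0 <= rnorm x.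
Proof. by rewrite -ler0c -rnormE. Qed.

Lemma rnormD (x y : V) : rnorm (x + y) <= rnorm x + rnorm y.
Proof. by rewrite -lecR rmorphD/= -!rnormE ler_normD. Qed.

Lemma rnormZ (a : R[i]) (x : V) : rnorm (a *: x) = complex.Re `|a| * rnorm x.
Proof.
apply: complexI; rewrite -rnormE normrZ rmorphM/= -rnormE.
by congr (_ * _); rewrite RRe_real// ger0_real.
Qed.

Lemma rnorm0_eq0 (x : V) : rnorm x = 0 -> x = 0.
Proof. by move=> x0; apply/normr0_eq0; rewrite rnormE x0. Qed.

End RealNorm.

(* A submodule W of a normed module V, as a normed module for the norm of V. *)
Record normed_subspace (K : numFieldType) (V : normedModType K)
    (W : submodClosed V) := NormedSubspace
  { subspace_val :> V ; _ : subspace_val \in W }.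

Section NormedSubspace.
Context (K : numFieldType) (V : normedModType K) (W : submodClosed V).

HB.instance Definition _ := [isSub for @subspace_val K V W].
HB.instance Definition _ := [Choice of normed_subspace W by <:].
HB.instance Definition _ := [SubChoice_isSubLmodule of normed_subspace W by <:].

Definition subspace_norm (v : normed_subspace W) : K := `|val v|.

Lemma subspace_normD v w :
  subspace_norm (v + w) <= subspace_norm v + subspace_norm w.
Proof. exact: ler_normD. Qed.

Lemma subspace_normZ a v : subspace_norm (a *: v) = `|a| * subspace_norm v.
Proof. exact: normrZ. Qed.

Lemma subspace_norm0_eq0 v : subspace_norm v = 0 -> v = 0.
Proof. by move/normr0_eq0 => v0; exact: val_inj. Qed.

HB.instance Definition _ := Lmodule_isNormed.Build K (normed_subspace W)
  subspace_normD subspace_normZ subspace_norm0_eq0.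

End NormedSubspace.

Definition cb_pred (R : realType) (T : topologicalType)
    (X : normedModType R[i]) : {pred T -> X} :=
  mem [set f : T -> X | continuous f /\ bounded_fun f].

Arguments cb_pred {R} T X.

(* C_b(T, X), with the supremum norm *)
Record Cb (R : realType) (T : topologicalType) (X : normedModType R[i]) :=
  MkCb { cb_fun :> T -> X ; _ : cb_fun \in cb_pred T X }.

Section Cb.
Context {R : realType} {T : topologicalType} {X : normedModType R[i]}.

HB.instance Definition _ := [isSub for @cb_fun R T X].
HB.instance Definition _ := [Choice of Cb T X by <:].

Lemma cb_predP (f : T -> X) :
  f \in cb_pred T X <->
  continuous f /\ exists M : R, forall t, rnorm (f t) <= M.
Proof.
rewrite inE /=; split=> -[cf bf]; split=> //.
  have [M [Mr MB]] := bf.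
  exists (complex.Re M + 1) => t.
  rewrite -lecR -rnormE rmorphD/= RRe_real//.
  by apply: MB => //; rewrite ltrDl.
have [M MB] := bf.
exists M%:C; split; first by apply/complex_realP; exists M.
move=> x Mx t _ /=; rewrite rnormE (le_trans _ (ltW Mx))// lecR; exact: MB.
Qed.

Fact cb_submod_closed : submod_closed (cb_pred T X).
Proof.
split.
  apply/cb_predP; split; first by move=> t; exact: cvg_cst.
  by exists 0 => t; rewrite /rnorm normr0.
move=> a f g /cb_predP[cf [M fM]] /cb_predP[cg [N gN]]; apply/cb_predP; split.
  by move=> t; apply: cvgD; [apply: cvgZr; exact: cf | exact: cg].
exists (complex.Re `|a| * M + N) => t.
rewrite (le_trans (rnormD _ _))// lerD// rnormZ ler_wpM2l//.
exact: (rnorm_ge0 (a : R[i]^o)).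
Qed.

HB.instance Definition _ :=
  GRing.isSubmodClosed.Build R[i] (T -> X) (cb_pred T X) cb_submod_closed.
HB.instance Definition _ := [SubChoice_isSubLmodule of Cb T X by <:].

Lemma cb_continuous (f : Cb T X) : continuous f.
Proof. by have /cb_predP[] := valP f. Qed.

Lemma cb_bounded (f : Cb T X) : exists M : R, forall t, rnorm (f t) <= M.
Proof. by have /cb_predP[] := valP f. Qed.

Definition cb_norm (f : Cb T X) : R[i] := (sup (range (rnorm \o f)))%:C.

Lemma cb_has_sup (f : Cb T X) : T -> has_sup (range (rnorm \o f)).
Proof.
move=> t; split; first by exists (rnorm (f t)), t.
by have [M fM] := cb_bounded f; exists M => _ [s _ <-]; exact: fM.
Qed.

Lemma cb_norm_ub (f : Cb T X) (t : T) : rnorm (f t) <= sup (range (rnorm \o f)).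
Proof. by apply: (sup_upper_bound (cb_has_sup f t)); exists t. Qed.

Lemma cb_norm_empty (f : Cb T X) :
  (T -> False) -> sup (range (rnorm \o f)) = 0.
Proof.
move=> T0; suff -> : range (rnorm \o f) = set0 by rewrite sup0.
by rewrite -subset0 => y [t _ _]; case: (T0 t).
Qed.

Lemma cb_norm_le (f : Cb T X) (M : R) :
  0 <= M -> (forall t, rnorm (f t) <= M) -> sup (range (rnorm \o f)) <= M.
Proof.
move=> M0 fM; have [[t]|T0] := pselect (inhabited T).
  apply: ge_sup; first by exists (rnorm (f t)), t.
  by move=> _ [s _ <-]; exact: fM.
by rewrite cb_norm_empty// => t; apply: T0.
Qed.

Lemma cb_norm_ge0 (f : Cb T X) : 0 <= sup (range (rnorm \o f)).
Proof.
have [[t]|T0] := pselect (inhabited T).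
  exact: le_trans (rnorm_ge0 _) (cb_norm_ub f t).
by rewrite cb_norm_empty// => t; apply: T0.
Qed.

Lemma cb_normD (f g : Cb T X) : cb_norm (f + g) <= cb_norm f + cb_norm g.
Proof.
rewrite /cb_norm -rmorphD lecR; apply: cb_norm_le => [|t].
  by rewrite addr_ge0 ?cb_norm_ge0.
exact: le_trans (rnormD _ _) (lerD (cb_norm_ub f t) (cb_norm_ub g t)).
Qed.

Lemma cb_norm0_eq0 (f : Cb T X) : cb_norm f = 0 -> f = 0.
Proof.
move=> /complexI f0; apply/val_inj/funext => t; apply: rnorm0_eq0.
by apply/eqP; rewrite eq_le rnorm_ge0 -f0 cb_norm_ub.
Qed.

Lemma cb_normZ (a : R[i]) (f : Cb T X) : cb_norm (a *: f) = `|a| * cb_norm f.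
Proof.
have le_normZ (b : R[i]) (g : Cb T X) : cb_norm (b *: g) <= `|b| * cb_norm g.
  rewrite (@rnormE R R[i]^o b) /cb_norm -rmorphM lecR.
  apply: cb_norm_le => [|t]; first by rewrite mulr_ge0 ?cb_norm_ge0 ?rnorm_ge0.
  by rewrite /= rnormZ ler_wpM2l ?cb_norm_ub//; exact: (@rnorm_ge0 R R[i]^o).
apply/eqP; rewrite eq_le le_normZ /=; have [->|a0] := eqVneq a 0.
  by rewrite normr0 mul0r /cb_norm ler0c cb_norm_ge0.
rewrite -ler_pdivlMl ?normr_gt0// -normfV.
by apply: le_trans (le_normZ _ _); rewrite scalerA mulVf// scale1r.
Qed.

HB.instance Definition _ := Lmodule_isNormed.Build R[i] (Cb T X)
  cb_normD cb_normZ cb_norm0_eq0.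

Lemma rnorm_cb (f : Cb T X) : rnorm f = sup (range (rnorm \o f)).
Proof. by []. Qed.

End Cb.

Section CbOperations.
Context {R : realType} {T : topologicalType} {X : normedModType R[i]}.

Fact cst_cb_pred (x : X) : cst x \in cb_pred T X.
Proof.
apply/cb_predP; split; first by move=> t; exact: cvg_cst.
by exists (rnorm x) => t.
Qed.

Definition cb_cst (x : X) : Cb T X := MkCb (cst_cb_pred x).

Fact mul_cb_pred (f : Cb T R[i]^o) (g : Cb T X) :
  (fun t => (f t : R[i]) *: g t) \in cb_pred T X.
Proof.
apply/cb_predP; split.
  by move=> t; apply: cvgZ; exact: cb_continuous.
have [M fM] := cb_bounded f; have [N gN] := cb_bounded g.
by exists (M * N) => t; rewrite rnormZ ler_pM ?rnorm_ge0//;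
  [exact: (@rnorm_ge0 R R[i]^o) | exact: fM].
Qed.

(* the pointwise product t |-> f(t) g(t); for X = R[i]^o this is the product
   of the algebra C_b(T) *)
Definition cb_mul (f : Cb T R[i]^o) (g : Cb T X) : Cb T X :=
  MkCb (mul_cb_pred f g).

End CbOperations.

Section FunctionAlgebra.
Context {R : realType} {T : topologicalType}.
Implicit Types (A : set (Cb T R[i]^o)) (S : set T).

Definition function_algebra A : Prop :=
  [/\ forall (a : R[i]) f g, A f -> A g -> A (a *: f + g),
      forall f g, A f -> A g -> A (cb_mul f g),
      closed A,
      forall s t, s <> t -> exists2 f, A f & f s <> f t
    & forall c : R[i]^o, A (cb_cst c)].

Definition strong_peak_point A (t0 : T) : Prop :=
  exists2 f, A f &
    rnorm (f t0) = rnorm f /\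
    forall U : set T, open_nbhs t0 U ->
      sup [set rnorm (f t) | t in ~` U] < rnorm f.

Definition norming A S : Prop :=
  forall f, A f -> rnorm f = sup [set rnorm (f t) | t in S].

End FunctionAlgebra.

Section VectorValued.
Context {R : realType} {T : topologicalType} {X : normedModType R[i]}.

Definition base_algebra (AX : submodClosed (Cb T X)) : set (Cb T R[i]^o) :=
  [set phi | exists f : Cb T X, f \in AX /\
     exists x' : {linear X -> R[i]^o},
       continuous x' /\ forall t, phi t = x' (f t)].

(* the standing assumptions on a space A(T, X) *)
Definition vector_function_space (AX : submodClosed (Cb T X)) : Prop :=
  [/\ closed [set` AX],
      function_algebra (base_algebra AX),
      forall phi (x : X), base_algebra AX phi -> cb_mul phi (cb_cst x) \in AX
    & forall f g, base_algebra AX f -> g \in AX -> cb_mul f g \in AX].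

End VectorValued.

Section Daugavet.
Context {R : realType}.

Definition bounded_operator (Z : normedModType R[i]) (S : Z -> Z) : Prop :=
  exists M : R, forall z, rnorm (S z) <= M * rnorm z.

(* the operator norm, for a bounded linear S *)
Definition opnorm (Z : normedModType R[i]) (S : Z -> Z) : R :=
  sup [set rnorm (S z) | z in [set z | rnorm z <= 1]].

Definition rank_one (Z : normedModType R[i]) (S : {linear Z -> Z}) : Prop :=
  exists2 z0 : Z, z0 <> 0 & range S = [set c *: z0 | c in [set: R[i]]].

Definition daugavet (Z : normedModType R[i]) : Prop :=
  forall S : {linear Z -> Z}, bounded_operator S -> rank_one S ->
    opnorm (fun z => z + S z) = 1 + opnorm S.

End Daugavet.

(* Main.v *)
Require Import Defs.
From HB Require Import structures.
From mathcomp Require Import all_boot all_order all_algebra.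
From mathcomp Require Import all_classical all_reals all_analysis.
From mathcomp Require Import ring lra.
Import Order.TTheory GRing.Theory Num.Theory.
Import numFieldNormedType.Exports.
Local Open Scope classical_set_scope.
Local Open Scope ring_scope.
Local Open Scope complex_scope.

(* A normed space has the Daugavet property iff, for every [z0 <> 0], every
   slice of its ball contains a point [y] with [||y + z0||] near [1 + ||z0||].
   To find such a point in A(Omega, X) for a functional [phi] and a function
   [g], take [f0] in the slice, a strong peak point [t0] with [||g(t0)||] near
   [||g||] (Hahn-Banach reduces this to the scalar norming hypothesis), and
   [p] in [A] with [p(t0)] near [1], [p] small off a neighbourhood of [t0] on
   which [f0] is nearly constant, and [|p| + |1 - p| <= 1 + eps]. Choose [y] in
   [X] by the slice property for the functional [x |-> phi(p x)] and the vector
   [g(t0)]. Then [f = (1 - p) f0 + p y] has norm at most [(1 + eps)^2], lies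
   almost in the slice because [phi(p f0)] is near [phi(p f0(t0))], and
   [f(t0) + g(t0)] is near [y + g(t0)].

   If [h] in [A] peaks at [t0] with [h(t0) = ||h|| = 1], then [p] is the average
   over [j < n] of [u_j = 1 / (1 + 2^j (1 - h))]. With [a = 2^j |1 - h|] one has
   [|u_j| + |1 - u_j| <= 1 + min(a, 1/a)], and the excesses sum to at most [4]
   over all scales, so [|p| + |1 - p| <= 1 + 4/n]. *)

Set Implicit Arguments.
Unset Strict Implicit.
Unset Printing Implicit Defensive.

Local Notation cmod a := (@rnorm _ _^o a).

(** * Norms with real values *)

Section Modulus.
Context {R : realType}.
Implicit Types (a b : R[i]) (r : R).

Lemma cmodM a b : cmod (a * b) = cmod a * cmod b.
Proof. exact: (@rnormZ R R[i]^o). Qed.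

Lemma cmodR r : cmod r%:C = `|r|.
Proof. by rewrite /rnorm normc_def /= expr0n addr0 sqrtr_sqr. Qed.

Lemma cmod1 : cmod (1 : R[i]) = 1.
Proof. by rewrite (cmodR 1) normr1. Qed.

Lemma cmod_sqr a : cmod a ^+ 2 = complex.Re a ^+ 2 + complex.Im a ^+ 2.
Proof.
by rewrite /rnorm normc_def /= sqr_sqrtr// addr_ge0// sqr_ge0.
Qed.

Lemma Re_le_cmod a : complex.Re a <= cmod a.
Proof.
apply: le_trans (ler_norm _) _; rewrite -lecR -[X in _ <= X]rnormE.
exact: normc_ge_Re.
Qed.

Lemma rnormN (V : normedModType R[i]) (x : V) : rnorm (- x) = rnorm x.
Proof. by rewrite /rnorm normrN. Qed.

Lemma rnorm0 (V : normedModType R[i]) : rnorm (0 : V) = 0.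
Proof. by rewrite /rnorm normr0. Qed.

Lemma rnormB (V : normedModType R[i]) (x y : V) :
  rnorm x - rnorm y <= rnorm (x - y).
Proof. by rewrite lerBlDr (le_trans _ (rnormD _ _))// subrK. Qed.

Lemma rnormBC (V : normedModType R[i]) (x y : V) :
  rnorm (x - y) = rnorm (y - x).
Proof. by rewrite -rnormN opprB. Qed.

Lemma rnormZE (V : normedModType R[i]) a (x : V) :
  rnorm (a *: x) = cmod a * rnorm x.
Proof. exact: rnormZ. Qed.

Lemma rnorm_gt0 (V : normedModType R[i]) (x : V) : x <> 0 -> 0 < rnorm x.
Proof.
move=> x0; rewrite lt_neqAle rnorm_ge0 andbT eq_sym.
by apply/eqP => /rnorm0_eq0.
Qed.

Lemma cmodV a : cmod a^-1 = (cmod a)^-1.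
Proof.
have [->|a0] := eqVneq a 0; first by rewrite invr0 rnorm0 invr0.
have Na0 : cmod a != 0 by apply/eqP => /rnorm0_eq0 /eqP; exact/negP.
by apply: (mulfI Na0); rewrite mulfV// -cmodM mulfV// cmod1.
Qed.

(** Rotating a vector by [l] makes a functional real and nonnegative there without changing the norm
    of the vector. *)
Lemma phase a : exists2 l : R[i], cmod l = 1 & l * a = (cmod a)%:C.
Proof.
have [->|a0] := eqVneq a 0; first by exists 1; rewrite ?cmod1// mulr0 rnorm0.
have Na0 : cmod a != 0 by apply/eqP => /rnorm0_eq0 /eqP; exact/negP.
exists ((cmod a)%:C / a); last by rewrite mulfVK.
by rewrite cmodM cmodV cmodR ger0_norm ?rnorm_ge0// mulfV.
Qed.

End Modulus.

(** Bundles a map proved linear, so that functionals and operators can be built in the middle of a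
    proof. *)
Lemma linear_pack (K : pzRingType) (V W : lmodType K) (f : V -> W) :
  linear f -> exists g : {linear V -> W}, forall x, g x = f x.
Proof.
move=> f_lin; pose fL := GRing.isLinear.Build K V W *:%R f f_lin.
by exists (HB.pack f fL : {linear V -> W}).
Qed.

(** * The Hahn-Banach theorem *)

Section Sublinear.
Context {R : realType} {V : normedModType R[i]}.
Implicit Types (q : V -> R) (x y : V).

(** Homogeneity is a one-sided inequality for [s > 0], a form that passes to infima; applying it to
    [s^-1] gives the converse. *)
Definition sublinear q := [/\ forall x y, q (x + y) <= q x + q y
  & forall (s : R) x, 0 < s -> q (s%:C *: x) <= s * q x].

(* A minimal sublinear [q] equals each [tilt q y] and [tilt q y (- y) <= - q y],
   so [q] is odd, hence linear. *)
Definition tilt q y x : R :=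
  inf [set q (x + t%:C *: y) - t * q y | t in [set t : R | 0 <= t]].

Lemma sublinear0 q : sublinear q -> 0 <= q 0.
Proof. by move=> [qD _]; have := qD 0 0; rewrite addr0; lra. Qed.

Lemma sublinear_ge q x : sublinear q -> - q (- x) <= q x.
Proof.
move=> q_sub; have [qD _] := q_sub.
by have := qD x (- x); rewrite subrr; have := sublinear0 q_sub; lra.
Qed.

Lemma sublinearZ q (t : R) x : q 0 <= 0 -> sublinear q -> 0 <= t ->
  q (t%:C *: x) <= t * q x.
Proof.
move=> q0 [_ qZ]; rewrite le_eqVlt => /orP[/eqP <-|/qZ//].
by rewrite scale0r mul0r.
Qed.


Lemma sublinearZ_ge q (t : R) x : sublinear q -> 0 <= t ->
  t * q x <= q (t%:C *: x).
Proof.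
move=> q_sub; have [_ qZ] := q_sub; rewrite le_eqVlt => /orP[/eqP <-|t0].
  by rewrite mul0r scale0r sublinear0.
have := qZ t^-1 (t%:C *: x); rewrite invr_gt0 => /(_ t0).
rewrite scalerA -rmorphM mulVf ?gt_eqF// scale1r => h.
by rewrite -ler_pdivlMl.
Qed.

Lemma tilt_le q x y (t : R) : sublinear q -> 0 <= t ->
  tilt q y x <= q (x + t%:C *: y) - t * q y.
Proof.
move=> q_sub t0; apply: ge_inf; last by exists t.
(* The infimum is finite: [t * q y <= q (t y) <= q (x + t y) + q (- x)]. *)
have [qD _] := q_sub; exists (- q (- x)) => _ [s s0 <-].
have := qD (x + s%:C *: y) (- x); rewrite addrAC subrr add0r.
by have := sublinearZ_ge y q_sub s0; lra.
Qed.

Lemma le_infD (A B : set R) c : A !=set0 -> B !=set0 ->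
  (forall a b, A a -> B b -> c <= a + b) -> c <= inf A + inf B.
Proof.
move=> A0 B0 cAB; rewrite -lerBlDr; apply: lb_le_inf => // a Aa.
rewrite lerBlDr -lerBlDl; apply: lb_le_inf => // b Bb.
by rewrite lerBlDl; exact: cAB.
Qed.

Lemma le_infM (A : set R) s c : A !=set0 -> 0 < s ->
  (forall a, A a -> c <= s * a) -> c <= s * inf A.
Proof.
move=> A0 s0 cA; rewrite -ler_pdivrMl//; apply: lb_le_inf => // a Aa.
by rewrite ler_pdivrMl//; exact: cA.
Qed.

(** Parameters [s] for [x] and [t] for [x'] combine into [s + t] for the sum, and scaling [x] by [s]
    scales the parameter by [s]. *)
Lemma tilt_sublinear q y : sublinear q -> sublinear (tilt q y).
Proof.
move=> q_sub; have [qD qZ] := q_sub.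
have S0 x :
    [set q (x + t%:C *: y) - t * q y | t in [set t : R | 0 <= t]] !=set0.
  by exists (q (x + (0 : R)%:C *: y) - 0 * q y), 0 => /=.
split=> [x x'|s x s0].
  apply: le_infD => // _ _ [s /= s0 <-] [t /= t0 <-].
  apply: le_trans (tilt_le _ _ q_sub (addr_ge0 s0 t0)) _.
  have := qD (x + s%:C *: y) (x' + t%:C *: y).
  by rewrite addrACA -scalerDl -rmorphD/=; lra.
apply: le_infM => // _ [t /= t0 <-].
apply: le_trans (tilt_le _ _ q_sub (mulr_ge0 (ltW s0) t0)) _.
have := qZ s (x + t%:C *: y) s0.
by rewrite scalerDr scalerA -rmorphM/=; lra.
Qed.

(** Zorn's lemma for the reversed pointwise order. A chain is bounded by its pointwise infimum,
    which is subadditive because the smaller of two members serves for both summands. *)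
Lemma minimal_sublinear (p : V -> R) : sublinear p -> p 0 <= 0 ->
  exists q, [/\ sublinear q, forall x, q x <= p x &
    forall r, sublinear r -> (forall x, r x <= q x) -> r = q].
Proof.
move=> p_sub p0.
pose S := {q : V -> R | sublinear q /\ forall x, q x <= p x}.
pose le (q r : S) := `[< forall x, sval r x <= sval q x >].
have [||||[q [q_sub qp]] qmin] := @Zorn S le.
- by move=> q; apply/asboolP.
- move=> q r s /asboolP qr /asboolP rs; apply/asboolP => x.
  exact: le_trans (rs x) (qr x).
- move=> [q qP] [r rP] /asboolP /= qr /asboolP /= rq.
  apply: eq_exist; apply/funext => x.
  by apply/eqP; rewrite eq_le rq qr.
(* Adjoining [p], which dominates every member, keeps a chain and makes it nonempty. *)
- move=> F Ftot; pose G := F `|` [set exist _ p (conj p_sub (fun=> lexx _))].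
  have Gp (q : S) x : G q -> sval q x <= p x by case: q => /= q [].
  have Gsub (q : S) : G q -> sublinear (sval q) by case: q => /= q [].
  have Gtot (q r : S) : G q -> G r ->
      (forall x, sval r x <= sval q x) \/ (forall x, sval q x <= sval r x).
    move=> [Fq|->] [Fr|->]; last by left.
    + by have [/asboolP|/asboolP] := Ftot _ _ Fq Fr; [left|right].
    + by right; case: q Fq => /= q [].
    + by left; case: r Fr => /= r [].
  pose E x := [set sval q x | q in G].
  have E0 x : E x !=set0 by exists (p x); eexists; [right; reflexivity|].
  pose Q x := inf (E x).
  have Q_le (q : S) x : G q -> Q x <= sval q x.
    move=> Gq; apply: ge_inf; last by exists q.
    exists (- p (- x)) => _ [r Gr <-].
    apply: le_trans (sublinear_ge x (Gsub _ Gr)).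
    by rewrite lerN2; exact: Gp.
  have Qsub : sublinear Q.
    split=> [x y|s x s0].
      apply: le_infD => // _ _ [q Gq <-] [r Gr <-].
      have [qr|qr] := Gtot _ _ Gq Gr.
        have [rD _] := Gsub _ Gr; apply: le_trans (Q_le _ _ Gr) _.
        by rewrite (le_trans (rD _ _))// lerD2r.
      have [qD _] := Gsub _ Gq; apply: le_trans (Q_le _ _ Gq) _.
      by rewrite (le_trans (qD _ _))// lerD2l.
    apply: le_infM => // _ [q Gq <-]; apply: le_trans (Q_le _ _ Gq) _.
    by have [_] := Gsub _ Gq; exact.
  have Qp x : Q x <= p x by exact: (Q_le _ _ (or_intror erefl)).
  exists (exist _ Q (conj Qsub Qp)) => q Fq; apply/asboolP => x /=.
  by apply: Q_le; left.
exists q; split=> // r r_sub rq.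
have rp x : r x <= p x by exact: le_trans (qp x).
have := qmin (exist _ r (conj r_sub rp)).
by move=> /(_ (asboolT rq)) /(congr1 sval).
Qed.

Lemma hahn_banach_real (x0 : V) : exists u : V -> R,
  [/\ forall x y, u (x + y) = u x + u y,
      forall (s : R) x, u (s%:C *: x) = s * u x,
      forall x, u x <= rnorm x & u x0 = rnorm x0].
Proof.
have norm_sub : sublinear (fun x : V => rnorm x).
  split=> [x y|s x s0]; first exact: rnormD.
  by rewrite rnormZE cmodR gtr0_norm.
have tilt00 q y : sublinear q -> q 0 <= 0 -> tilt q y 0 <= 0.
  move=> q_sub q0; apply: le_trans (tilt_le 0 y q_sub (lexx 0)) _.
  by rewrite scale0r addr0 mul0r subr0.
have tilt_lex q y x : sublinear q -> tilt q y x <= q x.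
  move=> q_sub; apply: le_trans (tilt_le x y q_sub (lexx 0)) _.
  by rewrite scale0r addr0 mul0r subr0.
have tiltN q y : sublinear q -> q 0 <= 0 -> tilt q y (- y) <= - q y.
  move=> q_sub q0; apply: le_trans (tilt_le (- y) y q_sub ler01) _.
  by rewrite scale1r addNr mul1r; lra.
have n00 : rnorm (0 : V) <= 0 by rewrite rnorm0.
(* Starting below the norm tilted along [x0], and not below the norm itself, forces
   [u (- x0) <= - rnorm x0], hence equality at [x0]. *)
have [u [u_sub up umin]] := minimal_sublinear (tilt_sublinear x0 norm_sub)
  (tilt00 _ x0 norm_sub n00).
have u0 : u 0 <= 0 by apply: le_trans (up 0) _; exact: tilt00.
have uN y : u (- y) = - u y.
  apply/eqP; rewrite eq_le; apply/andP; split.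
    rewrite -[X in X (- y)](umin _ (tilt_sublinear y u_sub)).
      exact: tiltN.
    by move=> x; exact: tilt_lex.
  by have := sublinear_ge (- y) u_sub; rewrite opprK.
have [uD uZ] := u_sub.
have uE (s : R) x : 0 <= s -> u (s%:C *: x) = s * u x.
  by move=> s0; apply/eqP; rewrite eq_le sublinearZ// sublinearZ_ge.
exists u; split.
- move=> x y; apply/eqP; rewrite eq_le uD /=.
  by have := uD (- x) (- y); rewrite -opprD !uN; lra.
- move=> s x; have [s0|s0] := leP 0 s; first exact: uE.
  by rewrite -[s]opprK rmorphN scaleNr uN uE ?mulNr// oppr_ge0 ltW.
- by move=> x; apply: le_trans (up x) _; exact: tilt_lex.
- apply/eqP; rewrite eq_le; apply/andP; split.
    by apply: le_trans (up x0) _; exact: tilt_lex.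
  rewrite -lerN2 -uN; apply: le_trans (up _) _; exact: tiltN.
Qed.

(** The real functional [u] is complexified as [u x - i u (i x)]; the bound on the modulus follows
    by rotating [x] until the value is real. *)
Lemma hahn_banach_norming (x0 : V) : exists f : {linear V -> R[i]^o},
  (forall x, cmod (f x) <= rnorm x) /\ cmod (f x0) = rnorm x0.
Proof.
have [u [uD uZ up ux0]] := hahn_banach_real x0.
pose f x : R[i]^o := u x -i* u ('i *: x).
have f_additive : {morph f : x y / x + y}.
  by move=> x y; apply/eqP; rewrite eq_complex /= scalerDr !uD opprD !eqxx.
have f_scalable : scalable f.
  move=> [a b] x.
  have abE (z : V) : (a +i* b) *: z = a%:C *: z + b%:C *: ('i *: z).
    rewrite scalerA -scalerDl; congr (_ *: z); apply/eqP.
    by rewrite eq_complex /=; apply/andP; split; apply/eqP; ring.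
  rewrite /f scalerA mulrC -scalerA !abE !uD !uZ scalerA.
  have -> : 'i * 'i = - 1 :> R[i] by rewrite -expr2 sqr_i.
  have -> : u (- 1 *: x) = - u x.
    by rewrite -[- 1](rmorphN1 (real_complex R)) uZ mulN1r.
  apply/eqP; rewrite eq_complex /=; apply/andP; split; apply/eqP; ring.
have [g gE] : exists g : {linear V -> R[i]^o}, forall x, g x = f x.
  by apply: linear_pack => a x y; rewrite f_additive f_scalable.
have Re_g x : complex.Re (g x) = u x by rewrite gE.
have g_le x : cmod (g x) <= rnorm x.
  have [l l1 lgx] := phase (g x).
  have <- : complex.Re (g (l *: x)) = cmod (g x).
    by rewrite linearZ; change (complex.Re (l * g x) = cmod (g x)); rewrite lgx.
  by rewrite Re_g (le_trans (up _))// rnormZE l1 mul1r.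
exists g; split=> //; apply/eqP; rewrite eq_le g_le /= -ux0 -Re_g.
exact: Re_le_cmod.
Qed.

End Sublinear.

(** * The Daugavet property in terms of slices *)

Definition bounded_functional (R : realType) (Z : normedModType R[i])
    (phi : {linear Z -> R[i]^o}) : Prop :=
  exists M : R, forall z, cmod (phi z) <= M * rnorm z.

(** Selects one error [eta] whose total cost [eta * k] fits a prescribed budget. *)
Lemma exists_small {R : realType} (k e : R) : 0 <= k -> 0 < e ->
  exists eta : R, [/\ 0 < eta, eta <= 1 & eta * k <= e].
Proof.
move=> k0 e0; have k1 : 0 < k + 1 by lra.
exists (Num.min 1 (e / (k + 1))); split.
- by rewrite lt_min ltr01 divr_gt0.
- by rewrite ge_min lexx.
- have h : Num.min 1 (e / (k + 1)) <= e / (k + 1) by rewrite ge_min lexx orbT.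
  apply: le_trans (ler_wpM2r k0 h) _.
  by rewrite mulrAC ler_pdivrMr// mulrDr mulr1 lerDl ltW.
Qed.

(* Allowing radius [1 + eps] instead of [1] is harmless, by rescaling [y]. *)
Definition daugavet_slices (R : realType) (Z : normedModType R[i]) : Prop :=
  forall (phi : {linear Z -> R[i]^o}) (z0 : Z) (eps : R),
    bounded_functional phi -> z0 <> 0 -> 0 < eps ->
    exists y : Z, [/\ rnorm y <= 1 + eps,
      forall z, rnorm z <= 1 -> cmod (phi z) <= complex.Re (phi y) + eps
      & 1 + rnorm z0 - eps <= rnorm (y + z0)].

(** * Bounded functionals, operator norms, and slices from the Daugavet property *)

Section FunctionalTheory.
Context {R : realType} {Z : normedModType R[i]}.
Implicit Types (phi : {linear Z -> R[i]^o}) (z : Z).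

Lemma bounded_functionalP phi : bounded_functional phi <->
  exists2 M : R, 0 <= M & forall z, cmod (phi z) <= M * rnorm z.
Proof.
split=> [[M phiM]|[M _ phiM]]; last by exists M.
exists `|M| => // z; apply: le_trans (phiM z) _.
by rewrite ler_wpM2r ?rnorm_ge0// ler_norm.
Qed.

Lemma bounded_functional_continuous phi :
  bounded_functional phi -> continuous phi.
Proof.
move=> /bounded_functionalP [M M0 phiM]; apply: bounded_linear_continuous.
exists M%:C; split; first by apply/complex_realP; exists M.
move=> N MN; near=> z => /=; rewrite rnormE (le_trans _ (ltW MN))// lecR.
apply: le_trans (phiM z) _; rewrite ler_piMr// -lecR -rnormE.
near: z; apply: nbhs0_le; exact: ltr01.
Unshelve. all: by end_near. Qed.

Lemma functional_sup phi (eps : R) : bounded_functional phi -> 0 < eps ->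
  exists y : Z, rnorm y <= 1 /\
    forall z, rnorm z <= 1 -> cmod (phi z) <= complex.Re (phi y) + eps.
Proof.
move=> /bounded_functionalP [M M0 phiM] eps0.
pose E := [set cmod (phi z) | z in [set z | rnorm z <= 1]].
have E_sup : has_sup E.
  split; first by exists (cmod (phi 0)), 0 => //=; rewrite rnorm0.
  by exists M => _ [z /= z1 <-]; apply: le_trans (phiM z) _; rewrite ler_piMr.
have [_ [y0 /= y01 <-] y0E] := sup_adherent eps0 E_sup.
have [l l1 lphi] := phase (phi y0).
exists (l *: y0); split=> [|z z1]; first by rewrite rnormZE l1 mul1r.
have -> : complex.Re (phi (l *: y0)) = cmod (phi y0).
  rewrite linearZ; change (complex.Re (l * phi y0) = cmod (phi y0)).
  by rewrite lphi.
rewrite -lerBlDr (le_trans _ (ltW y0E))// lerB//.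
by apply: sup_upper_bound => //; exists z.
Qed.

Section OperatorNorm.
Variable S : Z -> Z.
Hypothesis Sb : bounded_operator S.

Lemma opnorm_has_sup :
  has_sup [set rnorm (S z) | z in [set z | rnorm z <= 1]].
Proof.
split; first by exists (rnorm (S 0)), 0 => //=; rewrite rnorm0.
have [M SM] := Sb; exists `|M| => _ [z /= z1 <-]; apply: le_trans (SM z) _.
by rewrite (le_trans (ler_wpM2r (rnorm_ge0 _) (ler_norm M)))// ler_piMr.
Qed.

Lemma opnorm_ub z : rnorm z <= 1 -> rnorm (S z) <= opnorm S.
Proof. by move=> z1; apply: (sup_upper_bound opnorm_has_sup); exists z. Qed.

Lemma opnorm_le (M : R) : (forall z, rnorm z <= 1 -> rnorm (S z) <= M) ->
  opnorm S <= M.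
Proof.
move=> SM; apply: ge_sup; first by have [] := opnorm_has_sup.
by move=> _ [z /= z1 <-]; exact: SM.
Qed.

Lemma opnorm_gt (M : R) : M < opnorm S ->
  exists2 z, rnorm z <= 1 & M < rnorm (S z).
Proof.
by move=> /(sup_gt (proj1 opnorm_has_sup))[_ [z /= z1 <-] ?]; exists z.
Qed.

End OperatorNorm.

(** Rescaling to the unit ball. Asking only [scalable] lets it apply to the unbundled map [z + S z],
    on the radius [1 + e] of the slice condition. *)
Lemma opnorm_ubM (S : Z -> Z) (r : R) z : bounded_operator S -> scalable S ->
  0 < r -> rnorm z <= r -> rnorm (S z) <= r * opnorm S.
Proof.
move=> Sb SZ r0 zr; have rC0 : r%:C != 0 by rewrite gt_eqF// (ltcR 0).
rewrite -[z](scalerKV rC0) SZ rnormZE cmodR gtr0_norm// ler_pM2l//.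
apply: opnorm_ub => //; rewrite rnormZE cmodV cmodR gtr0_norm//.
by rewrite ler_pdivrMl// mulr1.
Qed.


Lemma bounded_operatorD (S : Z -> Z) :
  bounded_operator S -> bounded_operator (fun z => z + S z).
Proof.
move=> [M SM]; exists (1 + M) => z; apply: le_trans (rnormD _ _) _.
by rewrite mulrDl mul1r lerD2l.
Qed.

(** With [c] the norm of [phi], the operator [S z = (phi z / c) z0] has norm [rnorm z0]. A point
    almost attaining the norm of [z + S z] must have [cmod (phi z)] close to [c]; rotated, it lies
    in the slice and its image is close to the point plus [z0]. *)
Lemma daugavet_daugavet_slices : daugavet Z -> daugavet_slices Z.
Proof.
move=> dZ phi z0 eps phib z00 eps0; have w0 := rnorm_gt0 z00.
(* For [phi = 0] every point is in the slice, and the unit vector along [z0] gives exactly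
   [1 + rnorm z0]. *)
have [phi0|] := pselect (forall z, phi z = 0).
  have yz0 : rnorm ((rnorm z0)^-1%:C *: z0) = 1.
    by rewrite rnormZE cmodR ger0_norm ?invr_ge0 ?rnorm_ge0// mulVf// gt_eqF.
  exists ((rnorm z0)^-1%:C *: z0); split.
  - by rewrite yz0 lerDl ltW.
  - by move=> z _; rewrite !phi0 rnorm0 /= add0r ltW.
  - have -> : (rnorm z0)^-1%:C *: z0 + z0 = ((rnorm z0)^-1 + 1)%:C *: z0.
      by rewrite rmorphD scalerDl scale1r.
    rewrite rnormZE cmodR ger0_norm ?addr_ge0 ?invr_ge0 ?rnorm_ge0//.
    by rewrite mulrDl mulVf ?gt_eqF// mul1r lerBlDr lerDl ltW.
move=> /existsNP [z1 /eqP phiz1].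
have [M M0 phiM] := (bounded_functionalP _).1 phib.
pose E := [set cmod (phi z) | z in [set z | rnorm z <= 1]].
have E_sup : has_sup E.
  split; first by exists (cmod (phi 0)), 0 => //=; rewrite rnorm0.
  by exists M => _ [z /= z1' <-]; apply: le_trans (phiM z) _; rewrite ler_piMr.
pose c := sup E.
have phic z : rnorm z <= 1 -> cmod (phi z) <= c.
  by move=> zle; apply: sup_upper_bound => //; exists z.
have c0 : 0 < c.
  have z10 : 0 < rnorm z1.
    by apply: rnorm_gt0 => z10; move: phiz1; rewrite z10 linear0 eqxx.
  apply: lt_le_trans (phic ((rnorm z1)^-1%:C *: z1) _); last first.
    by rewrite rnormZE cmodR gtr0_norm ?invr_gt0// mulVf// gt_eqF.
  rewrite linearZ (rnormZE (V := R[i]^o)) cmodR gtr0_norm ?invr_gt0//.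
  by rewrite mulr_gt0 ?invr_gt0//; apply: rnorm_gt0; exact/eqP.
have c0' : c != 0 by rewrite gt_eqF.
have cC0 : c%:C != 0 by rewrite gt_eqF// (ltcR 0).
have [S SE] : exists S : {linear Z -> Z}, forall z,
    S z = (phi z * (c^-1)%:C : R[i]) *: z0.
  apply: linear_pack => a x y; rewrite linearP scalerA -scalerDl.
  by congr (_ *: _); change ((a * phi x + phi y) * c^-1%:C =
    a * (phi x * c^-1%:C) + phi y * c^-1%:C); ring.
have rnormS z : rnorm (S z) = cmod (phi z) / c * rnorm z0.
  by rewrite SE rnormZE cmodM cmodR gtr0_norm ?invr_gt0.
have Sb : bounded_operator S.
  exists (M / c * rnorm z0) => z; rewrite rnormS.
  have -> : M / c * rnorm z0 * rnorm z = (M * rnorm z) / c * rnorm z0 by ring.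
  by rewrite ler_wpM2r ?rnorm_ge0// ler_wpM2r ?invr_ge0 ?(ltW c0).
have S1 : rank_one S.
  exists z0 => //; apply/seteqP; split=> [_ [z _ <-]|_ [a _ <-]].
    by exists (phi z * c^-1%:C : R[i]).
  exists ((a * c%:C / phi z1) *: z1) => //; rewrite SE linearZ.
  congr (_ *: _).
  change ((a * c%:C / phi z1) * phi z1 * c^-1%:C = a).
  by rewrite mulfVK// -mulrA -rmorphM mulfV// mulr1.
have oS : opnorm S = rnorm z0.
  apply/eqP; rewrite eq_le; apply/andP; split.
    apply: opnorm_le => // z z1'; rewrite rnormS ler_piMl ?rnorm_ge0//.
    by rewrite ler_pdivrMr// mul1r phic.
  have : c <= opnorm S * c / rnorm z0.
    apply: ge_sup; first by have [] := E_sup.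
    move=> _ [z /= z1' <-]; rewrite ler_pdivlMr// -ler_pdivrMr// mulrAC -rnormS.
    exact: opnorm_ub.
  by rewrite ler_pdivlMr// mulrC ler_pM2r.
(* The distance loses [e] from almost attaining the norm and [e] from replacing [a / c] by [1]; the
   slice loses [c - a <= e * (c / rnorm z0)]. *)
have [e [e0 _ ec]] : exists e : R,
    [/\ 0 < e, e <= 1 & e * (2 + c / rnorm z0) <= eps].
  by apply: exists_small => //; rewrite addr_ge0// divr_ge0// ltW.
have := dZ S Sb S1; rewrite oS => oIdS.
have [] := @opnorm_gt (fun z => z + S z) (bounded_operatorD Sb)
  (1 + rnorm z0 - e).
  by rewrite oIdS ltrBlDr ltrDl.
move=> z zle zS.
have [l l1 lphi] := phase (phi z).
set a := cmod (phi z) in lphi *.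
have ac : a <= c by exact: phic.
have phil : phi (l *: z) = a%:C by rewrite linearZ.
have aw : rnorm z0 - e <= a / c * rnorm z0.
  have := rnormD z (S z); rewrite rnormS -/a; lra.
have aw' : (1 - a / c) * rnorm z0 <= e by lra.
have ca : c - a <= e * (c / rnorm z0).
  rewrite mulrA ler_pdivlMr// -ler_pdivrMr//.
  by rewrite (_ : _ / c = (1 - a / c) * rnorm z0)//; field.
have erest : e * (2 + c / rnorm z0) = 2 * e + e * (c / rnorm z0) by ring.
have ecw : 0 <= e * (c / rnorm z0) by rewrite mulr_ge0// ?divr_ge0// ltW.
exists (l *: z); split.
- by rewrite rnormZE l1 mul1r (le_trans zle)// lerDl ltW.
- by move=> x /phic xc; rewrite phil /=; lra.
- have : rnorm (l *: z + (a / c)%:C *: z0) = rnorm (z + S z).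
    rewrite -[RHS]mul1r -l1 -rnormZE scalerDr SE scalerA.
    congr (rnorm (_ + _ *: _)).
    by rewrite mulrA lphi rmorphM.
  have -> : (a / c)%:C *: z0 = z0 + (a / c - 1)%:C *: z0.
    by rewrite rmorphB scalerBl scale1r addrC subrK.
  rewrite addrA; have := rnormD (l *: z + z0) ((a / c - 1)%:C *: z0).
  rewrite rnormZE cmodR distrC ger0_norm ?subr_ge0 ?ler_pdivrMr ?mul1r//.
  move: aw' zS; lra.
Qed.

End FunctionalTheory.

(** * The Daugavet property from slices *)

Section SlicesDaugavet.
Context {R : realType} {Z : normedModType R[i]}.

(** Write [S z = phi z *: z0] and let [c] be the norm of [phi]. The slice condition for the vector
    [c z0] gives [y] with [Re (phi y)] almost [c]; as [cmod (phi y)] hardly exceeds [c], [phi y] is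
    near [c] and [S y] near [c z0]. *)
Lemma daugavet_slices_daugavet : daugavet_slices Z -> daugavet Z.
Proof.
move=> dZ S Sb [z0 z00 rS]; have w0 := rnorm_gt0 z00.
have IdSb := bounded_operatorD Sb.
have z0I (a b : R[i]) : a *: z0 = b *: z0 -> a = b.
  move=> /eqP; rewrite -subr_eq0 -scalerBl scaler_eq0 subr_eq0.
  by move=> /orP[/eqP|/eqP].
have phi_ex z : exists a : R[i], a *: z0 = S z.
  by have : range S (S z) by [exists z]; rewrite rS => -[a _ <-]; exists a.
have [phi phiE] : exists phi : {linear Z -> R[i]^o},
    forall z, phi z = projT1 (cid (phi_ex z)).
  apply: linear_pack => a x y; apply: z0I.
  case: cid => c /= ->; case: cid => c1 /= c1E; case: cid => c2 /= c2E.
  by rewrite linearP scalerDl -scalerA c1E c2E.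
have SE z : S z = (phi z : R[i]) *: z0 by rewrite phiE; case: cid => c /= ->.
have rnormS z : rnorm (S z) = cmod (phi z) * rnorm z0 by rewrite SE rnormZE.
have phib : bounded_functional phi.
  have [M SM] := Sb; exists (M / rnorm z0) => z.
  by rewrite mulrAC ler_pdivlMr// -rnormS.
have SZ : scalable S by move=> a z; rewrite linearZ.
have IdSZ : scalable (fun z => z + S z).
  by move=> a z; rewrite linearZ /= scalerDr.
set o := opnorm S; set K := opnorm _.
have o0 : 0 < o.
  have [z1 _ Sz1] : range S z0 by rewrite rS; exists 1; rewrite ?scale1r.
  have r0 : 0 < 1 + rnorm z1 by rewrite ltr_pwDl// rnorm_ge0.
  have := @opnorm_ubM _ _ S _ z1 Sb SZ r0; rewrite lerDr ler01 => /(_ isT).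
  by rewrite Sz1 => /(lt_le_trans w0); rewrite pmulr_rgt0.
have Ko : K <= 1 + o.
  apply: opnorm_le => // z z1; apply: le_trans (rnormD _ _) _.
  by rewrite lerD// opnorm_ub.
apply/eqP; rewrite eq_le Ko /=.
apply/ler_addgt0Pr => eps eps0.
pose c := o / rnorm z0.
have c0 : 0 < c by rewrite divr_gt0.
have cw : c * rnorm z0 = o by rewrite mulfVK// gt_eqF.
have [d [d0 _ dw]] : exists d : R,
    [/\ 0 < d, d <= 1 & d * (2 * rnorm z0) <= eps].
  by apply: exists_small => //; rewrite mulr_ge0// ltW.
have c20 : 0 <= c ^+ 2 by rewrite sqr_ge0.
(* The final estimate loses [e * (2 + o)] and [d * rnorm z0], each at most [eps / 2]; the bound by
   [d ^+ 2] is for [cmod (c - phi y)]. *)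
have [e [e0 e1 es]] : exists e : R, [/\ 0 < e, e <= 1 &
    e * (2 * (2 + o) + (3 * c ^+ 2 + 2 * c)) <= Num.min eps (d ^+ 2)].
  by apply: exists_small; [lra | rewrite lt_min eps0 exprn_gt0].
move: es; rewrite le_min => /andP[es1 es2].
have eo : 0 <= e * o by rewrite mulr_ge0// ltW.
have ec : 0 <= e * c by rewrite mulr_ge0// ltW.
have ec2 : 0 <= e * c ^+ 2 by rewrite mulr_ge0// ltW.
have es1' : e * (2 * (2 + o)) <= eps by lra.
have es2' : e * (3 * c ^+ 2 + 2 * c) <= d ^+ 2 by lra.
have cz0 : rnorm (c%:C *: z0) = o by rewrite rnormZE cmodR gtr0_norm.
have cz00 : c%:C *: z0 <> 0.
  by move=> /(congr1 rnorm); rewrite rnorm0 cz0 => /eqP; rewrite gt_eqF.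
have [y [y1 phiy yz]] := dZ phi (c%:C *: z0) e phib cz00 e0.
have e1r : 0 < 1 + e by lra.
have cRe : c <= complex.Re (phi y) + e.
  rewrite ler_pdivrMr//; apply: opnorm_le => // z z1.
  by rewrite rnormS ler_wpM2r ?phiy// ltW.
have phiyc : cmod (phi y) <= (1 + e) * c.
  rewrite /c mulrA ler_pdivlMr// -rnormS; exact: opnorm_ubM.
(* Expand [|c - phi y|^2 = c^2 - 2 c Re (phi y) + |phi y|^2] and insert [Re (phi y) >= c - e] and
   [|phi y| <= (1 + e) c]: at most [e (3 c^2 + 2 c)] remains. *)
have Dd : cmod (c%:C - phi y : R[i]) <= d.
  rewrite -ler_sqr ?nnegrE ?rnorm_ge0 ?(ltW d0)//.
  have : cmod (phi y) ^+ 2 <= ((1 + e) * c) ^+ 2.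
    rewrite ler_sqr ?nnegrE ?rnorm_ge0//.
    by rewrite mulr_ge0 ?ltW.
  move: cRe; rewrite !cmod_sqr; case: (phi y : R[i]) => a b /= cRe h.
  have h2 : c * (c - e) <= c * a by rewrite ler_pM2l//; lra.
  have h3 : e * (e * c ^+ 2) <= e * c ^+ 2 by rewrite ler_piMl.
  nra.
have := opnorm_ubM IdSb IdSZ e1r y1; rewrite -/K.
have : rnorm (y + c%:C *: z0) <= rnorm (y + S y) + d * rnorm z0.
  have -> : y + c%:C *: z0 = (y + S y) + (c%:C - phi y : R[i]) *: z0.
    by rewrite SE scalerBl addrA addrAC addrK.
  by rewrite (le_trans (rnormD _ _))// lerD2l rnormZE ler_wpM2r// ltW.
have : e * K <= e * (1 + o) by rewrite ler_pM2l.
rewrite mulrDl mul1r; move: yz; rewrite cz0; lra.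
Qed.

End SlicesDaugavet.

(** * Peak functions close to [0, 1] *)

Section Resolvent.
Context {R : realType}.
Implicit Types (w : R[i]) (a : R).

Definition resolvent w : R[i] := (1 + w)^-1.

(** From [|1 + w|^2 = 1 + 2 Re w + |w|^2]. *)
Lemma cmod_1D w : 0 <= complex.Re w -> Num.max 1 (cmod w) <= cmod (1 + w).
Proof.
move=> w0; have h : 1 + cmod w ^+ 2 <= cmod (1 + w) ^+ 2.
  by rewrite !cmod_sqr; case: w w0 => x y /= x0; nra.
rewrite ge_max -(@ler_sqr _ 1) ?nnegrE ?rnorm_ge0//.
rewrite -(@ler_sqr _ (cmod w)) ?nnegrE ?rnorm_ge0//.
have := sqr_ge0 (cmod w); lra.
Qed.

(** As [1 - resolvent w = w * resolvent w], the left side is [(1 + |w|) / |1 + w|], and [|1 + w|] is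
    at least [max (1, |w|)]. At [w = 0] the convention [0^-1 = 0] makes the minimum vanish. *)
Lemma resolvent_sum w : 0 <= complex.Re w ->
  cmod (resolvent w) + cmod (1 - resolvent w) <=
    1 + Num.min (cmod w) (cmod w)^-1.
Proof.
move=> w0; have := cmod_1D w0; rewrite ge_max => /andP[h1 h2].
have n0 : 0 < cmod (1 + w) by exact: lt_le_trans ltr01 h1.
have w1 : 1 + w != 0 by apply: contraTneq n0 => ->; rewrite rnorm0 ltxx.
have -> : 1 - resolvent w = w * resolvent w.
  by apply: (mulIf w1); rewrite mulrBl mul1r /resolvent mulfVK// mulVf//; ring.
rewrite cmodM /resolvent cmodV -[X in X + _]mul1r -mulrDl ler_pdivrMr//.
have [->|wn0] := eqVneq (cmod w) 0.
  by rewrite invr0 minxx !addr0 mul1r.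
have wp : 0 < cmod w by rewrite lt_neqAle eq_sym wn0 rnorm_ge0.
have [wle|wle] := leP (cmod w) (cmod w)^-1.
  by rewrite ler_peMr// ltW// addr_gt0.
apply: le_trans (ler_wpM2l _ h2); last by rewrite addr_ge0// invr_ge0 ltW.
by rewrite mulrDl mul1r mulVf// addrC.
Qed.

(** Peeling off [j = 0] replaces [a] by [2 a]. The two-case bound is chosen to survive this:
    [a + (4 - 2 a) = 4 - a] and [1/a + 1/a = 2/a], while for [1/2 < a <= 1] one has
    [a + 1/a <= 4 - a]. *)
Lemma geometric_min_sum (n : nat) a : 0 < a ->
  \sum_(j < n) Num.min (2 ^+ j * a) (2 ^+ j * a)^-1 <=
    if a <= 1 then 4 - a else 2 / a.
Proof.
elim: n a => [|n IH] a a0.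
  rewrite big_ord0; case: ifP => a1; first lra.
  by rewrite divr_ge0// ltW.
rewrite big_ord_recl /= expr0 mul1r.
have -> : \sum_(i < n) Num.min (2 ^+ (bump 0 i) * a) (2 ^+ (bump 0 i) * a)^-1 =
    \sum_(j < n) Num.min (2 ^+ j * (2 * a)) (2 ^+ j * (2 * a))^-1.
  by apply: eq_bigr => i _; rewrite /bump /= exprSr -mulrA.
have a20 : 0 < 2 * a by rewrite mulr_gt0.
have := IH _ a20; rewrite invfM mulrA mulfV// mul1r.
have ma : Num.min a a^-1 <= a by rewrite ge_min lexx.
have mV : Num.min a a^-1 <= a^-1 by rewrite ge_min lexx orbT.
case: (leP a 1) => a1; case: (leP (2 * a) 1) => a2; try lra.
have : a^-1 <= 2 by rewrite -[2]invrK lef_pV2 ?posrE//; lra.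
lra.
Qed.

Lemma geometric_inv_sum (n : nat) a : 0 < a ->
  \sum_(j < n) (2 ^+ j * a)^-1 <= 2 / a.
Proof.
elim: n a => [|n IH] a a0; first by rewrite big_ord0 divr_ge0// ltW.
rewrite big_ord_recl /= expr0 mul1r.
have -> : \sum_(i < n) (2 ^+ (bump 0 i) * a)^-1 =
    \sum_(j < n) (2 ^+ j * (2 * a))^-1.
  by apply: eq_bigr => i _; rewrite /bump /= exprSr -mulrA.
have a20 : 0 < 2 * a by rewrite mulr_gt0.
have := IH _ a20; rewrite invfM mulrA mulfV// mul1r; lra.
Qed.

Lemma rnorm_sum (V : normedModType R[i]) (I : Type) (r : seq I) (F : I -> V) :
  rnorm (\sum_(i <- r) F i) <= \sum_(i <- r) rnorm (F i).
Proof.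
elim/big_ind2: _ => [|x1 x2 y1 y2 h1 h2|//]; first by rewrite rnorm0.
exact: le_trans (rnormD _ _) (lerD h1 h2).
Qed.

Definition multiscale (n : nat) w : R[i] :=
  (n%:R^-1 : R)%:C * \sum_(j < n) resolvent ((2 ^+ j : R)%:C * w).

Lemma cmod_multiscale (n : nat) w :
  cmod (multiscale n w) <=
    n%:R^-1 * \sum_(j < n) cmod (resolvent ((2 ^+ j : R)%:C * w)).
Proof.
rewrite cmodM cmodR ger0_norm ?invr_ge0// ler_wpM2l ?invr_ge0//.
exact: (@rnorm_sum R[i]^o).
Qed.

Lemma Re_scale (r : R) w : complex.Re (r%:C * w) = r * complex.Re w.
Proof. by case: w => x y /=; rewrite mul0r subr0. Qed.

Lemma pow2_gt0 (j : nat) : 0 < (2 ^+ j : R).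
Proof. exact: exprn_gt0. Qed.

Lemma multiscale0 (n : nat) : (0 < n)%N -> multiscale n 0 = 1.
Proof.
move=> n0; rewrite /multiscale (eq_bigr (fun=> 1)) => [|j _]; last first.
  by rewrite mulr0 /resolvent addr0 invr1.
rewrite sumr_const card_ord -(rmorph_nat (real_complex R)) -rmorphM.
by rewrite mulVf// pnatr_eq0 -lt0n.
Qed.

Lemma multiscale_sum (n : nat) w : (0 < n)%N -> 0 <= complex.Re w ->
  cmod (multiscale n w) + cmod (1 - multiscale n w) <= 1 + 4 / n%:R.
Proof.
move=> n0 w0.
have nR0 : n%:R != 0 :> R by rewrite pnatr_eq0 -lt0n.
have E : 1 - multiscale n w =
    (n%:R^-1 : R)%:C * \sum_(j < n) (1 - resolvent ((2 ^+ j : R)%:C * w)).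
  rewrite /multiscale sumrB mulrBr; congr (_ - _).
  rewrite sumr_const card_ord -(rmorph_nat (real_complex R)) -rmorphM.
  by rewrite mulVf.
have : cmod (1 - multiscale n w) <=
    n%:R^-1 * \sum_(j < n) cmod (1 - resolvent ((2 ^+ j : R)%:C * w)).
  rewrite E cmodM cmodR ger0_norm ?invr_ge0// ler_wpM2l ?invr_ge0//.
  exact: (@rnorm_sum R[i]^o).
move=> /(lerD (cmod_multiscale n w)) /le_trans; apply.
rewrite -mulrDr -big_split /= ler_pdivrMl ?ltr0n// mulrDr mulr1.
rewrite mulrC mulfVK//.
have S j : cmod (resolvent ((2 ^+ j : R)%:C * w)) +
    cmod (1 - resolvent ((2 ^+ j : R)%:C * w)) <=
    1 + Num.min (2 ^+ j * cmod w) (2 ^+ j * cmod w)^-1.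
  apply: le_trans (resolvent_sum _) _.
    by rewrite Re_scale mulr_ge0// ltW// pow2_gt0.
  by rewrite cmodM cmodR gtr0_norm// pow2_gt0.
apply: (@le_trans _ _
  (\sum_(j < n) (1 + Num.min (2 ^+ j * cmod w) (2 ^+ j * cmod w)^-1))).
  by apply: ler_sum => j _; exact: S.
rewrite big_split /= sumr_const card_ord lerD2l.
have [->|wn0] := eqVneq (cmod w) 0.
  by rewrite big1 // => j _; rewrite mulr0 invr0 minxx.
have wp : 0 < cmod w by rewrite lt_neqAle eq_sym wn0 rnorm_ge0.
apply: le_trans (geometric_min_sum _ wp) _; case: ifP => a1; first lra.
rewrite ler_pdivrMr//; move/negbT: a1; rewrite -ltNge; lra.
Qed.

(** The terms are at most [1 / (2^j |w|)], so their sum is below [2 / d] for any number of scales,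
    and averaging divides it by [n]. *)
Lemma multiscale_small (n : nat) w (d : R) : 0 <= complex.Re w ->
  0 < d -> d <= cmod w -> cmod (multiscale n w) <= n%:R^-1 * (2 / d).
Proof.
move=> w0 d0 dw; have wp : 0 < cmod w by exact: lt_le_trans dw.
apply: le_trans (cmod_multiscale _ _) _; rewrite ler_wpM2l ?invr_ge0//.
have S j : cmod (resolvent ((2 ^+ j : R)%:C * w)) <= (2 ^+ j * cmod w)^-1.
  have := @cmod_1D ((2 ^+ j : R)%:C * w).
  rewrite Re_scale mulr_ge0// ?(ltW (pow2_gt0 _))// => /(_ isT).
  rewrite ge_max cmodM cmodR gtr0_norm ?pow2_gt0// => /andP[h1 h2].
  rewrite /resolvent cmodV lef_pV2 ?posrE//; last first.
    by rewrite mulr_gt0// pow2_gt0.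
  exact: lt_le_trans h1.
apply: (@le_trans _ _ (\sum_(j < n) (2 ^+ j * cmod w)^-1)).
  by apply: ler_sum => j _; exact: S.
apply: le_trans (geometric_inv_sum _ wp) _.
by rewrite ler_wpM2l// lef_pV2.
Qed.

End Resolvent.

(** * Uniform approximation by members of a function algebra *)

Section PeakFunctions.
Context {R : realType} {T : topologicalType}.
Variable A : set (Cb T R[i]^o).
Hypothesis A_alg : function_algebra A.
Implicit Types (F G : T -> R[i]) (h p : Cb T R[i]^o).

(** Stated for bare functions, so that resolvents and their averages need not be packaged as
    elements of [Cb]. *)
Definition approximable F := forall eps : R, 0 < eps ->
  exists2 p, A p & forall t, cmod (p t - F t) <= eps.

Lemma cb_linE (X : normedModType R[i]) (a : R[i]) (f g : Cb T X) t :
  (a *: f + g) t = a *: f t + g t.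
Proof. by []. Qed.

Lemma approximable_cst (c : R[i]) : approximable (fun=> c).
Proof.
have [_ _ _ _ Acst] := A_alg => eps eps0.
by exists (cb_cst (c : R[i]^o)) => // t; rewrite subrr rnorm0 ltW.
Qed.

Lemma approximable_lin (a : R[i]) F G : approximable F -> approximable G ->
  approximable (fun t => a * F t + G t).
Proof.
have [Alin _ _ _ _] := A_alg => AF AG eps eps0.
have [d [d0 _ da]] :=
  exists_small (addr_ge0 (rnorm_ge0 (a : R[i]^o)) ler01) eps0.
have [p Ap pF] := AF _ d0; have [q Aq qG] := AG _ d0.
exists (a *: p + q); first exact: Alin.
move=> t; rewrite cb_linE.
have -> : a *: p t + q t - (a * F t + G t) =
    a * (p t - F t : R[i]) + (q t - G t : R[i]) :> R[i].
  by rewrite mulrBr opprD addrACA.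
apply: le_trans (rnormD (V := R[i]^o) _ _) _; rewrite cmodM.
have := ler_wpM2l (rnorm_ge0 (a : R[i]^o)) (pF t).
have := qG t; lra.
Qed.

Lemma approximable_sum (n : nat) (F : nat -> T -> R[i]) :
  (forall j, approximable (F j)) -> approximable (fun t => \sum_(j < n) F j t).
Proof.
move=> AF; elim: n => [|n IH].
  by under eq_fun do rewrite big_ord0; exact: approximable_cst.
under eq_fun do rewrite big_ord_recr /= -[X in X + _]mul1r.
exact: approximable_lin.
Qed.

(* With [r = k / (1 + k)], the value [v = resolvent (k * (1 - h))] is the fixed
   point of [u |-> (1 + k)^-1 + r * h * u]; iterate from [0]. *)
Lemma approximable_resolvent h (k : R) : A h -> (forall t, cmod (h t) <= 1) ->
  0 <= k -> approximable (fun t => resolvent (k%:C * (1 - h t))).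
Proof.
move=> Ah h1 k0 eps eps0; have [Alin Amul _ _ Acst] := A_alg.
have k1 : 0 < 1 + k by rewrite ltr_pwDl.
have k1C : (1 + k%:C : R[i]) != 0.
  by rewrite -(rmorphD (real_complex R) 1) gt_eqF// (ltcR 0).
pose r := k / (1 + k).
have r0 : 0 <= r by rewrite divr_ge0// ltW.
have r1 : r < 1 by rewrite ltr_pdivrMr// mul1r ltrDr.
pose v t := resolvent (k%:C * (1 - h t)).
have Re0 t : 0 <= complex.Re (k%:C * (1 - h t)).
  rewrite Re_scale mulr_ge0//.
  by have := le_trans (Re_le_cmod (h t)) (h1 t);
    case: (h t : R[i]) => x y /=; lra.
have v1 t : cmod (v t) <= 1.
  have := cmod_1D (Re0 t); rewrite ge_max => /andP[n1 _].
  by rewrite /v /resolvent cmodV invf_le1// (lt_le_trans ltr01).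
have vE t : v t = r%:C * (h t * v t) + ((1 + k)^-1)%:C :> R[i].
  have n0 : 1 + k%:C * (1 - h t) != 0.
    have := cmod_1D (Re0 t); rewrite ge_max => /andP[n1 _].
    by apply: contraTneq n1 => ->; rewrite rnorm0 -ltNge.
  rewrite /r rmorphM fmorphV rmorphD /v /resolvent.
  field.
  by rewrite k1C.
(* The initial error is [|v| <= 1], and each iteration multiplies it by at most [r |h| <= r]. *)
have S n : exists2 p, A p & forall t, cmod (p t - v t : R[i]) <= r ^+ n.
  elim: n => [|n [p Ap pv]].
    exists (cb_cst (0 : R[i]^o)) => // t.
    by rewrite sub0r (@rnormN _ R[i]^o) expr0.
  exists ((r%:C : R[i]) *: cb_mul h p + cb_cst (((1 + k)^-1)%:C : R[i]^o)).
    by apply: Alin => //; exact: Amul.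
  move=> t; rewrite cb_linE vE.
  have -> : (r%:C : R[i]) *: cb_mul h p t + ((1 + k)^-1)%:C -
      (r%:C * (h t * v t) + ((1 + k)^-1)%:C) =
      r%:C * (h t * (p t - v t : R[i])) :> R[i].
    have E (a x y z c : R[i]) :
      a * (x * y) + c - (a * (x * z) + c) = a * (x * (y - z)).
      by ring.
    exact: E.
  rewrite !cmodM cmodR ger0_norm// exprS ler_wpM2l//.
  by rewrite -[X in _ <= X]mul1r ler_pM// rnorm_ge0.
have [n rn] : exists n, r ^+ n <= eps.
  have /cvgrPdist_lt/(_ _ eps0)[n _ /(_ n (leqnn n))] :
    (r ^+ n @[n --> \oo] --> (0 : R)) by apply: cvg_expr; rewrite ger0_norm.
  by rewrite sub0r normrN ger0_norm ?exprn_ge0// => /ltW rn; exists n.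
have [p Ap pv] := S n; exists p => // t; exact: le_trans (pv t) rn.
Qed.

Lemma approximable_multiscale h (n : nat) :
  A h -> (forall t, cmod (h t) <= 1) ->
  approximable (fun t => multiscale n (1 - h t)).
Proof.
move=> Ah h1; have := @approximable_lin (n%:R^-1 : R)%:C _ _
  (@approximable_sum n (fun j t => resolvent ((2 ^+ j : R)%:C * (1 - h t)))
    (fun j => approximable_resolvent Ah h1 (exprn_ge0 j (ler0n R 2))))
  (approximable_cst 0).
by under eq_fun do rewrite addr0.
Qed.

Lemma strong_peak_function (t0 : T) (U : set T) (eps : R) :
  strong_peak_point A t0 -> open_nbhs t0 U -> 0 < eps ->
  exists p, [/\ A p, forall t, cmod (p t) + cmod (1 - p t) <= 1 + eps,
    forall t, ~ U t -> cmod (p t) <= eps & cmod (1 - p t0) <= eps].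
Proof.
have [Alin _ _ _ Acst] := A_alg => -[f Af [ft0 fU]] Ut0 eps0.
(* For [U = setT] the supremum is over the empty set, hence [0], and the peak inequality is
   strict. *)
have f_pos : 0 < rnorm f.
  have := fU setT; rewrite setCT image_set0 sup0; apply.
  by split=> //; exact: openT.
have ft00 : f t0 != 0.
  by apply: contraTneq f_pos => ft0'; rewrite -ft0 ft0' rnorm0 ltxx.
(* The zero constant is added to match the closure property for [a *: f + g]. *)
pose h : Cb T R[i]^o := ((f t0 : R[i])^-1) *: f + cb_cst (0 : R[i]^o).
have Ah : A h by exact: Alin.
have hE t : h t = (f t0 : R[i])^-1 * f t :> R[i] by rewrite /h cb_linE addr0.
have ht0 : h t0 = 1 by rewrite hE mulVf.
have hnorm t : cmod (h t) = cmod (f t) / rnorm f.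
  by rewrite (hE t) cmodM cmodV ft0 mulrC.
have h1 t : cmod (h t) <= 1.
  by rewrite hnorm ler_pdivrMr// mul1r; exact: cb_norm_ub.
set s := sup [set rnorm (f t) | t in ~` U].
have s_lt : s < rnorm f by exact: fU.
pose d := 1 - s / rnorm f.
have d0 : 0 < d by rewrite subr_gt0 ltr_pdivrMr// mul1r.
have hU t : ~ U t -> d <= cmod (1 - h t : R[i]).
  move=> Ut; apply: le_trans (rnormB (V := R[i]^o) _ _).
  rewrite cmod1 lerB// hnorm ler_pM2r ?invr_gt0//.
  apply: sup_upper_bound; last by exists t.
  split; first by exists (rnorm (f t)), t.
  by have [M fM] := cb_bounded f; exists M => _ [x _ <-].
have Re0 t : 0 <= complex.Re (1 - h t : R[i]).
  by have := le_trans (Re_le_cmod (h t)) (h1 t);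
    case: (h t : R[i]) => x y /=; lra.
have e0 : 0 < eps / 3 by rewrite divr_gt0.
(* [4 / n] is the excess of the average and [2 / (n d)] its size off [U]. Each is kept below
   [eps / 3]; the rest of [eps] pays for approximating both [|p|] and [|1 - p|]. *)
pose K := 4 + 2 / d.
have K0 : 0 < K by rewrite addr_gt0// divr_gt0.
have [n n0 nK] : exists2 n : nat, (0 < n)%N & n%:R^-1 * K <= eps / 3.
  have := archi_boundP (divr_ge0 (ltW K0) (ltW e0)).
  set n := Num.bound _ => nK; exists n.+1 => //.
  rewrite mulrC ler_pdivrMr ?ltr0n// mulrC -ler_pdivrMr//.
  by rewrite (le_trans (ltW nK))// ler_nat.
have [p Ap pE] := approximable_multiscale n Ah h1 e0.
have pE' t : cmod (p t) <= cmod (multiscale n (1 - h t)) + eps / 3.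
  have := rnormB (V := R[i]^o) (p t) (multiscale n (1 - h t)).
  by have := pE t; lra.
have pE1 t :
    cmod (1 - p t : R[i]) <= cmod (1 - multiscale n (1 - h t)) + eps / 3.
  have := rnormB (V := R[i]^o) (1 - p t) (1 - multiscale n (1 - h t)).
  have E (a b : R[i]) : 1 - a - (1 - b) = b - a by ring.
  rewrite E lerBlDl => /le_trans; apply.
  by rewrite lerD2l (rnormBC (V := R[i]^o)); exact: pE.
have d20 : 0 < 2 / d by rewrite divr_gt0.
have nV : 0 < n%:R^-1 :> R by rewrite invr_gt0 ltr0n.
exists p; split=> //.
- move=> t; have := multiscale_sum n0 (Re0 t); have := pE' t; have := pE1 t.
  have : 4 / n%:R <= eps / 3.
    apply: le_trans nK; rewrite mulrC ler_pM2l// lerDl ltW//.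
  lra.
- move=> t Ut; have := multiscale_small n (Re0 t) d0 (hU t Ut); have := pE' t.
  have : n%:R^-1 * (2 / d) <= eps / 3.
    apply: le_trans nK; rewrite ler_pM2l// lerDr ltW//.
  lra.
- have := pE1 t0; rewrite ht0 subrr multiscale0// subrr rnorm0; lra.
Qed.

End PeakFunctions.

(** * Slices of A(Omega, X) *)

Section VectorFunctions.
Context {R : realType} {T : topologicalType} {X : normedModType R[i]}.
Variable AX : submodClosed (Cb T X).
Local Notation Z := (normed_subspace AX).
Local Notation A := (base_algebra AX).
Implicit Types (f g : Z).

Lemma subspace_at_le f t : rnorm (val f t) <= rnorm f.
Proof. exact: cb_norm_ub. Qed.

Lemma subspace_norm_le f (M : R) : 0 <= M ->
  (forall t, rnorm (val f t) <= M) -> rnorm f <= M.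
Proof. exact: cb_norm_le. Qed.

Lemma subspace_atD f g t : val (f + g) t = val f t + val g t.
Proof. by rewrite GRing.valD. Qed.

Lemma subspace_atB f g t : val (f - g) t = val f t - val g t.
Proof. by rewrite GRing.valB. Qed.

(** Compose [g] with a norming functional at a point where [g] is almost maximal. The result is in
    the base algebra, is almost maximal somewhere on [S], and is dominated there by the norm of
    [g]. *)
Lemma norming_vector (S : set T) g (eps : R) : norming A S -> 0 < eps ->
  eps <= rnorm g -> exists2 t, S t & rnorm g - eps < rnorm (val g t).
Proof.
move=> normS eps0 epsg.
have [t gt] : exists t, rnorm g - eps / 2 < rnorm (val g t).
  have [] := @sup_gt _ (range (rnorm \o val g)) (rnorm g - eps / 2).
  - have [[t]|T0] := pselect (inhabited T).
      by exists (rnorm (val g t)), t.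
    have := lt_le_trans eps0 epsg; rewrite (_ : rnorm g = 0) ?ltxx//.
    by apply: cb_norm_empty => t; apply: T0.
  - by rewrite -[X in _ < X]/(rnorm g); lra.
  - by move=> _ [t _ <-] gt; exists t.
have [x' [x'1 x'g]] := hahn_banach_norming (val g t).
have x'c : continuous x'.
  by apply: bounded_functional_continuous; exists 1 => x; rewrite mul1r.
have phi_cb : ((fun s => x' (val g s)) : T -> R[i]^o) \in cb_pred T R[i]^o.
  apply/cb_predP; split.
    by move=> s; apply: continuous_comp; [exact: cb_continuous | exact: x'c].
  by exists (rnorm g) => s; apply: le_trans (x'1 _) _; exact: subspace_at_le.
pose phi : Cb T R[i]^o := MkCb phi_cb.
have Aphi : A phi by exists (val g); split; [exact: valP | exists x'].
have phig : rnorm g - eps / 2 < rnorm phi.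
  by apply: lt_le_trans gt _; rewrite -x'g; exact: (cb_norm_ub phi t).
(* Rules out an empty [S], over which [sup] would be [0]. *)
have gpos : 0 <= rnorm g - eps / 2 by lra.
move: phig; rewrite (normS _ Aphi) => phig.
have [] := @sup_gt _ [set rnorm (phi t) | t in S] (rnorm g - eps) _ _.
- apply/set0P; apply: contraTneq phig => ->; rewrite sup0 -leNgt.
  exact: gpos.
- by apply: lt_trans phig; lra.
- move=> _ [s Ss <-] phis; exists s => //; apply: lt_le_trans phis _.
  exact: x'1.
Qed.

Hypothesis AX_space : vector_function_space AX.

Lemma tensor p : A p -> exists m : {linear X -> Z},
  forall x t, val (m x) t = (p t : R[i]) *: x.
Proof.
have [_ _ tensorAX _] := AX_space => Ap.
have [|m mE] := @linear_pack R[i] X Z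
  (fun x => NormedSubspace (tensorAX _ x Ap)); last first.
  by exists m => x t; rewrite mE.
move=> a x y; apply/val_inj/val_inj/funext => t /=.
change ((p t : R[i]) *: (a *: x + y) =
  a *: ((p t : R[i]) *: x) + (p t : R[i]) *: y).
by rewrite scalerDr !scalerA mulrC.
Qed.

Hypothesis peaks_norming : norming A [set t | strong_peak_point A t].

Lemma vector_function_daugavet_slices : daugavet_slices X -> daugavet_slices Z.
Proof.
have [_ A_alg _ mulAX] := AX_space.
move=> dX phi g eta phib g0 eta0; have G0 := rnorm_gt0 g0.
have [M M0 phiM] := (bounded_functionalP _).1 phib.
(* The losses are at most [3 e] in the radius, [2 e + 2 M e] in the slice and [5 e] in the distance.
   Having [e <= rnorm g] allows [norming_vector] and keeps [g(t0)] nonzero. *)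
have [e [e0 e1 es]] : exists e : R, [/\ 0 < e, e <= 1 &
    e * (5 + 2 * M + 2) <= Num.min eta (rnorm g)].
  by apply: exists_small; [lra | rewrite lt_min eta0].
move: es; rewrite le_min => /andP[es1 es2].
have eM : 0 <= e * M by rewrite mulr_ge0// ltW.
have [f0 [f01 phif0]] := functional_sup phib e0.
have [t0 t0peak gt0] : exists2 t, strong_peak_point A t &
    rnorm g - e < rnorm (val g t).
  by apply: norming_vector => //; lra.
have gt00 : val g t0 <> 0 by move=> gt00; move: gt0; rewrite gt00 rnorm0; lra.
pose U := [set t | rnorm (val f0 t - val f0 t0) < e].
have Ut0 : open_nbhs t0 (interior U).
  split; first exact: open_interior.
  have /cvgrPdist_lt/(_ e%:C) : val f0 t @[t --> t0] --> val f0 t0.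
    exact: cb_continuous.
  rewrite (ltcR 0) => /(_ e0); rewrite /interior /=; apply: filterS => t.
  by rewrite rnormE ltcR rnormBC.
have [p [Ap p1 pU pt0]] := strong_peak_function A_alg t0peak Ut0 e0.
have [E EE] := tensor Ap.
pose P : Z := NormedSubspace (mulAX _ _ Ap (valP f0)).
have PE t : val P t = (p t : R[i]) *: val f0 t by [].
have [psi psiE] : exists psi : {linear X -> R[i]^o},
    forall x, psi x = phi (E x).
  by apply: linear_pack => a x y; rewrite linearP [phi _]linearP.
have Enorm x : rnorm (E x) <= (1 + e) * rnorm x.
  apply: subspace_norm_le => [|t]; first by rewrite mulr_ge0 ?rnorm_ge0//; lra.
  rewrite EE rnormZE ler_wpM2r ?rnorm_ge0//.
  by have := p1 t; have := rnorm_ge0 (1 - p t : R[i]^o); lra.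
have psib : bounded_functional psi.
  exists (M * (1 + e)) => x; rewrite psiE -mulrA.
  by apply: le_trans (phiM _) _; rewrite ler_wpM2l.
have [y [y1 psiy yg]] := dX psi (val g t0) e psib gt00 e0.
have f0t t : rnorm (val f0 t) <= 1 by exact: le_trans (subspace_at_le _ _) f01.
exists (f0 - P + E y); split.
- apply: subspace_norm_le => [|t]; first lra.
  rewrite subspace_atD subspace_atB PE EE -[X in X - _]scale1r -scalerBl.
  apply: le_trans (rnormD _ _) _; rewrite !rnormZE.
  have h1 : cmod (1 - p t : R[i]) * rnorm (val f0 t) <=
      cmod (1 - p t : R[i]) * (1 + e).
    by rewrite ler_wpM2l ?rnorm_ge0// (le_trans (f0t t))//; lra.
  have h2 : cmod (p t) * rnorm y <= cmod (p t) * (1 + e).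
    by rewrite ler_wpM2l ?rnorm_ge0.
  apply: le_trans (lerD h1 h2) _; rewrite -mulrDl addrC.
  have e1' : 0 <= 1 + e by lra.
  apply: le_trans (ler_wpM2r e1' (p1 t)) _; nra.
- move=> z /phif0 /le_trans; apply.
  (* On the neighbourhood [|p| <= 1 + e <= 2] and [f0] varies by at most [e]; off it [|p| <= e] and
     [f0] varies by at most [2]. *)
  have PEf : rnorm (E (val f0 t0) - P) <= 2 * e.
    apply: subspace_norm_le => [|t]; first lra.
    rewrite subspace_atB PE EE -scalerBr rnormZE.
    have [/interior_subset Ut|Ut] := pselect (interior U t).
      rewrite rnormBC ler_pM ?rnorm_ge0 ?(ltW Ut)//.
      by have := p1 t; have := rnorm_ge0 (1 - p t : R[i]^o); lra.
    rewrite mulrC ler_pM ?rnorm_ge0 ?pU//.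
    by have := rnormD (val f0 t0) (- val f0 t); rewrite rnormN;
      have := f0t t; have := f0t t0; lra.
  have h1 : complex.Re (phi (E (val f0 t0) - P)) >= - (M * (2 * e)).
    have := Re_le_cmod (- phi (E (val f0 t0) - P)).
    rewrite (rnormN (V := R[i]^o)).
    have := le_trans (phiM _) (ler_wpM2l M0 PEf).
    by case: (phi _ : R[i]) => a b /=; lra.
  have h2 : complex.Re (psi (val f0 t0)) <= complex.Re (psi y) + e.
    exact: le_trans (Re_le_cmod _) (psiy _ (f0t t0)).
  move: h1 h2; rewrite !psiE !linearD !linearN /=.
  lra.
- apply: le_trans (subspace_at_le _ t0).
  rewrite (subspace_atD _ g) (subspace_atD _ (E y)) subspace_atB PE EE.
  (* At [t0] the error against [y + g(t0)] is [(1 - p(t0)) (y - f0(t0))], of norm at most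
     [e (2 + e) <= 3 e]. *)
  have -> : val f0 t0 - (p t0 : R[i]) *: val f0 t0 + (p t0 : R[i]) *: y +
      val g t0 =
     (y + val g t0) - (1 - p t0 : R[i]) *: (y - val f0 t0).
    rewrite scalerBl scale1r scalerBr !opprD !opprK addrACA addNKr.
    by rewrite [X in _ = _ + X]addrC [_ + - _ in RHS]addrC !addrA.
  have := rnormB (y + val g t0) ((1 - p t0 : R[i]) *: (y - val f0 t0)).
  have : cmod (1 - p t0 : R[i]) * rnorm (y - val f0 t0) <= e * 3.
    rewrite ler_pM ?rnorm_ge0//.
    by have := rnormD y (- val f0 t0); rewrite rnormN; have := f0t t0; lra.
  rewrite rnormZE; lra.
Qed.

End VectorFunctions.

Theorem theorem3p16 (R : realType) (Omega : topologicalType)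
    (X : completeNormedModType R[i]) (AX : submodClosed (Cb Omega X)) :
  hausdorff_space Omega ->
  vector_function_space AX ->
  norming (base_algebra AX) [set t | strong_peak_point (base_algebra AX) t] ->
  daugavet X ->
  daugavet (normed_subspace AX).
Proof.
move=> _ AX_space peaks_norming dX; apply: daugavet_slices_daugavet.
apply: vector_function_daugavet_slices => //.
exact: daugavet_daugavet_slices.
Qed.
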